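(* Let $\mathbf{k}$ be a field, $X=\{x_1,\dots,x_n\}$ with $n\ge2$, $f\in\mathrm{Sym}(X)$, $\mathcal{A}=\mathcal{A}(\mathbf{k},X,r_f)$ the Yang-Baxter algebra of the permutation idempotent solution $(X,r_f)$, and let $d\ge2$. Let $w_q=x_1^{d-1}x_q\in\mathcal{A}_d$ for $1\le q\le n$, and let $F$ be the permutation of $\{w_1,\dots,w_n\}$ with $F(w_q)=x_1^{d-1}f^d(x_q)$. Let $(Y,r_{\mathfrak{F}})$ be the permutation idempotent solution on a set $Y=\{y_1,\dots,y_n\}$, where $\mathfrak{F}\in\mathrm{Sym}(Y)$ is given by $\mathfrak{F}(y_q)=y_j$ iff $F(w_q)=w_j$, and let $\mathfrak{A}=\mathcal{A}(\mathbf{k},Y,r_{\mathfrak{F}})$ be its Yang-Baxter algebra, $$\mathfrak{A}=\mathbf{k}\langle y_1,\dots,y_n\rangle/(\Re_d),\qquad\Re_d=\{y_py_q-y_1y_q\mid2\le p\le n,\ 1\le q\le n\}.$$ Then the assignment $y_i\mapsto w_i$, $1\le i\le n$, extends to an injective homomorphism of graded algebras $v_{n,d}:\mathfrak{A}\to\mathcal{A}$ (mapping $\mathfrak{A}_m$ into $\mathcal{A}_{md}$ for all $m$), called the $n,d$-Veronese map. The image of $v_{n,d}$ is the $d$-Veronese subalgebra $\mathcal{A}^{(d)}$.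
   Context: For a finite set $Z$ and $g\in\mathrm{Sym}(Z)$, the permutation idempotent solution $(Z,r_g)$ is $r_g(x,y)=(g(y),y)$ on $Z\times Z$, and its Yang-Baxter algebra is $\mathcal{A}(\mathbf{k},Z,r_g)=\mathbf{k}\langle Z\rangle/(xy-g(y)y\mid x,y\in Z)$, where $\mathbf{k}\langle Z\rangle$ is the free unital associative algebra; it is graded by word length. For a graded algebra $A=\bigoplus_{m\ge0}A_m$ the $d$-Veronese subalgebra is $A^{(d)}=\bigoplus_{m\ge0}A_{md}$, graded by $(A^{(d)})_m=A_{md}$. *)

(* Defs.v *)
From HB Require Import structures.
From mathcomp Require Import all_boot all_order all_fingroup all_algebra.
From mathcomp Require Import finmap boolp.
From mathcomp Require Import monalg.

Set Implicit Arguments.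
Unset Strict Implicit.
Unset Printing Implicit Defensive.

Import GRing.Theory.
Local Open Scope ring_scope.
Local Open Scope quotient_scope.

(* Quotient of a possibly noncommutative algebra by a proper two-sided ideal.
   [ring_quotient] provides the underlying Z-module quotient, but equips it with
   a product only for commutative rings. *)

HB.mixin Record isTwoSidedIdeal (R : nzRingType) (S : R -> bool) := {
  tsideal_mull : forall a : R, {in S, forall u, a * u \in S};
  tsideal_mulr : forall a : R, {in S, forall u, u * a \in S};
  tsideal_proper : (1 : R) \notin S
}.

#[short(type="tsideal")]
HB.structure Definition TwoSidedIdeal (R : nzRingType) :=
  {S of GRing.ZmodClosed R S & isTwoSidedIdeal R S}.

Definition quot_alg (R : nzRingType) (I : tsideal R) := Quotient.quot I.

Definition quot_proj (R : nzRingType) (I : tsideal R) (x : R) : quot_alg I :=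
  \pi_(Quotient.quot I) x.

Section QuotAlg.
Variables (k : comNzRingType) (R : algType k) (I : tsideal R).
Local Notation Q := (quot_alg I).
Local Notation pi := (quot_proj I).

HB.instance Definition _ := GRing.Zmodule.on Q.

Definition quot_repr (a : Q) : R := generic_quotient.repr a.

Lemma quot_reprK : cancel quot_repr pi.
Proof. by move=> a; rewrite /quot_proj /quot_repr reprK. Qed.

Lemma quot_projP (x y : R) : reflect (pi x = pi y) (x - y \in I).
Proof. by rewrite Quotient.idealrBE; apply: eqP. Qed.

Lemma quot_proj_is_zmod_morphism : zmod_morphism pi.
Proof. by move=> x y; rewrite /quot_proj raddfB. Qed.

HB.instance Definition _ :=
  GRing.isZmodMorphism.Build R Q pi quot_proj_is_zmod_morphism.

Definition quot_one : Q := pi 1.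
Definition quot_mul (a b : Q) : Q := pi (quot_repr a * quot_repr b).
Definition quot_scale (c : k) (a : Q) : Q := pi (c *: quot_repr a).

Lemma quot_mulE x y : quot_mul (pi x) (pi y) = pi (x * y).
Proof.
apply/quot_projP; set x' := quot_repr _; set y' := quot_repr _.
have -> : x' * y' - x * y = (x' - x) * y' + x * (y' - y).
  by rewrite mulrBl mulrBr addrA addrNK.
apply: rpredD; [apply: tsideal_mulr|apply: tsideal_mull];
  by apply/quot_projP; rewrite quot_reprK.
Qed.

Lemma quot_scaleE c x : quot_scale c (pi x) = pi (c *: x).
Proof.
apply/quot_projP; rewrite -scalerBr -mulr_algl; apply: tsideal_mull.
by apply/quot_projP; rewrite quot_reprK.
Qed.

Let qE := (quot_mulE, quot_scaleE).

Lemma quot_mulA : associative quot_mul.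
Proof.
move=> a b c; rewrite -[a]quot_reprK -[b]quot_reprK -[c]quot_reprK.
by rewrite !qE mulrA.
Qed.

Lemma quot_mul1q : left_id quot_one quot_mul.
Proof. by move=> a; rewrite -[a]quot_reprK qE mul1r. Qed.

Lemma quot_mulq1 : right_id quot_one quot_mul.
Proof. by move=> a; rewrite -[a]quot_reprK qE mulr1. Qed.

Lemma quot_mulDl : left_distributive quot_mul +%R.
Proof.
move=> a b c; rewrite -[a]quot_reprK -[b]quot_reprK -[c]quot_reprK.
by rewrite -raddfD !qE -raddfD mulrDl.
Qed.

Lemma quot_mulDr : right_distributive quot_mul +%R.
Proof.
move=> a b c; rewrite -[a]quot_reprK -[b]quot_reprK -[c]quot_reprK.
by rewrite -raddfD !qE -raddfD mulrDr.
Qed.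

Lemma quot_one_neq0 : quot_one != 0.
Proof.
rewrite /quot_one -(raddf0 pi); apply/eqP => /quot_projP.
by rewrite subr0; apply/negP/tsideal_proper.
Qed.

HB.instance Definition _ := GRing.Zmodule_isNzRing.Build Q
  quot_mulA quot_mul1q quot_mulq1 quot_mulDl quot_mulDr quot_one_neq0.

Lemma quot_scaleA a b x : quot_scale a (quot_scale b x) = quot_scale (a * b) x.
Proof. by rewrite -[x]quot_reprK !qE scalerA. Qed.

Lemma quot_scale1 : left_id 1 quot_scale.
Proof. by move=> x; rewrite -[x]quot_reprK qE scale1r. Qed.

Lemma quot_scaleDr : right_distributive quot_scale +%R.
Proof.
by move=> a x y; rewrite -[x]quot_reprK -[y]quot_reprK -raddfD !qE -raddfD scalerDr.
Qed.

Lemma quot_scaleDl x : {morph quot_scale^~ x : a b / a + b}.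
Proof. by move=> a b; rewrite -[x]quot_reprK !qE -raddfD scalerDl. Qed.

HB.instance Definition _ := GRing.Zmodule_isLmodule.Build k Q
  quot_scaleA quot_scale1 quot_scaleDr quot_scaleDl.

Lemma quot_scaleAl (c : k) (a b : Q) : c *: (a * b) = c *: a * b.
Proof.
rewrite -[LHS]/(quot_scale c (quot_mul a b)) -[RHS]/(quot_mul (quot_scale c a) b).
by rewrite -[a]quot_reprK -[b]quot_reprK !qE scalerAl.
Qed.

HB.instance Definition _ := GRing.Lmodule_isLalgebra.Build k Q quot_scaleAl.

Lemma quot_scaleAr (c : k) (a b : Q) : c *: (a * b) = a * (c *: b).
Proof.
rewrite -[LHS]/(quot_scale c (quot_mul a b)) -[RHS]/(quot_mul a (quot_scale c b)).
by rewrite -[a]quot_reprK -[b]quot_reprK !qE scalerAr.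
Qed.

HB.instance Definition _ := GRing.Lalgebra_isAlgebra.Build k Q quot_scaleAr.

Lemma quot_proj_is_monoid_morphism : monoid_morphism pi.
Proof. by split=> [|x y]; rewrite // -quot_mulE. Qed.

HB.instance Definition _ :=
  GRing.isMonoidMorphism.Build R Q pi quot_proj_is_monoid_morphism.

Lemma quot_proj_is_scalable : scalable pi.
Proof. by move=> c x; rewrite -quot_scaleE. Qed.

HB.instance Definition _ :=
  GRing.isScalable.Build k R Q *:%R pi quot_proj_is_scalable.

End QuotAlg.

Inductive ideal_gen (R : nzRingType) (S : R -> Prop) : R -> Prop :=
| IdealGen_base p of S p : ideal_gen S p
| IdealGen_0 : ideal_gen S 0
| IdealGen_B p q of ideal_gen S p & ideal_gen S q : ideal_gen S (p - q)
| IdealGen_Ml a p of ideal_gen S p : ideal_gen S (a * p)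
| IdealGen_Mr a p of ideal_gen S p : ideal_gen S (p * a).

(* The map r_g of the permutation idempotent solution (Z, r_g). *)
Definition perm_idem_sol (Z : finType) (g : {perm Z}) (xy : Z * Z) : Z * Z :=
  (g xy.2, xy.2).

(* The free unital associative algebra k<Z>: the monoid algebra of the free
   monoid of words on Z. *)
Definition free_alg (k : fieldType) (Z : finType) := {malg k[{fmonom Z}]}.

Section FreeAlg.
Variables (k : fieldType) (Z : finType).

HB.instance Definition _ := GRing.Lalgebra.on (free_alg k Z).

Lemma free_alg_scaleAr (c : k) (p q : free_alg k Z) : c *: (p * q) = p * (c *: q).
Proof.
suff cpC : p * malgC c = c *: p.
  by rewrite scalerAl -[c *: q]mul_malgC mulrA; congr (_ * q); rewrite cpC.
rewrite [in LHS](monalgE p) [in RHS](monalgE p) mulr_suml scaler_sumr.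
apply: eq_bigr => u _; apply/malgP => v.
by rewrite malgM_def fgmulUU mulm1 mcoeffZ !mcoeffU mulrnAr mulrC.
Qed.

HB.instance Definition _ :=
  GRing.Lalgebra_isAlgebra.Build k (free_alg k Z) free_alg_scaleAr.

Definition gen (z : Z) : free_alg k Z := << fmu z >>.

Definition homogeneous (m : nat) (p : free_alg k Z) : Prop :=
  forall u, u \in msupp p -> fdeg u = m.

(* The relations xy - y'x', where r(x, y) = (y', x'), attached to a map r. *)
Definition yb_rel (r : Z * Z -> Z * Z) (p : free_alg k Z) : Prop :=
  exists x y, p = gen x * gen y - gen (r (x, y)).1 * gen (r (x, y)).2.

Definition yb_ideal (r : Z * Z -> Z * Z) : free_alg k Z -> bool :=
  fun p => `[< ideal_gen (yb_rel r) p >].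

Variable r : Z * Z -> Z * Z.

Lemma yb_idealP p : reflect (ideal_gen (yb_rel r) p) (p \in yb_ideal r).
Proof. exact: asboolP. Qed.

Lemma yb_ideal_zmod_closed : zmod_closed (yb_ideal r).
Proof.
split=> [|p q /yb_idealP Ip /yb_idealP Iq]; apply/yb_idealP.
  exact: IdealGen_0.
exact: IdealGen_B.
Qed.

HB.instance Definition _ :=
  GRing.isZmodClosed.Build (free_alg k Z) (yb_ideal r) yb_ideal_zmod_closed.

Lemma yb_ideal_mull (a : free_alg k Z) :
  {in yb_ideal r, forall p, a * p \in yb_ideal r}.
Proof. by move=> p /yb_idealP Ip; apply/yb_idealP/IdealGen_Ml. Qed.

Lemma yb_ideal_mulr (a : free_alg k Z) :
  {in yb_ideal r, forall p, p * a \in yb_ideal r}.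
Proof. by move=> p /yb_idealP Ip; apply/yb_idealP/IdealGen_Mr. Qed.

Lemma gen_mul x y : gen x * gen y = << mmul (fmu x) (fmu y) >>.
Proof. by rewrite /gen [LHS]malgM_def fgmulUU mulr1. Qed.

Lemma yb_ideal_proper : 1 \notin yb_ideal r.
Proof.
pose ev0 (p : {malg k[{fmonom Z}]}) : k := p@_mone.
have ev0M (p q : free_alg k Z) : ev0 (p * q) = ev0 p * ev0 q by exact: rmorphM.
have ev0B (p q : free_alg k Z) : ev0 (p - q) = ev0 p - ev0 q by exact: raddfB.
have ev0g x y : ev0 (gen x * gen y) = 0.
  by rewrite ev0M {1}/ev0 mcoeffU fm1_eq1 mul0r.
suff I0 p : ideal_gen (yb_rel r) p -> ev0 p = 0.
  apply/negP => /yb_idealP /I0; rewrite /ev0 mcoeff1 eqxx.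
  by apply/eqP/oner_neq0.
elim=> {p} [p [x [y ->]]||p q _ Ip _ Iq|a p _ Ip|a p _ Ip].
- by rewrite ev0B !ev0g subrr.
- exact: raddf0.
- by rewrite ev0B Ip Iq subrr.
- by rewrite ev0M Ip mulr0.
- by rewrite ev0M Ip mul0r.
Qed.

HB.instance Definition _ := isTwoSidedIdeal.Build (free_alg k Z) (yb_ideal r)
  yb_ideal_mull yb_ideal_mulr yb_ideal_proper.

Definition yb_tsideal : tsideal (free_alg k Z) :=
  TwoSidedIdeal.clone (free_alg k Z) (yb_ideal r) _.

Definition yb_alg := quot_alg yb_tsideal.

HB.instance Definition _ := GRing.Algebra.on yb_alg.

Definition yb_gen (z : Z) : yb_alg := quot_proj yb_tsideal (gen z).

Definition yb_comp (m : nat) (a : yb_alg) : Prop :=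
  exists2 p : free_alg k Z, homogeneous m p & a = quot_proj yb_tsideal p.

End FreeAlg.
Arguments gen k {Z} z.
Arguments yb_alg k {Z} r.
Arguments yb_gen k {Z} r z.
Arguments yb_comp k {Z} r m a.

Section Veronese.
Variables (k : fieldType) (A : algType k) (C : nat -> A -> Prop) (d : nat).

Record is_grading : Prop := IsGrading {
  grading_lin m (c : k) a b : C m a -> C m b -> C m (c *: a + b);
  grading_1 : C 0 1;
  grading_mul m n a b : C m a -> C n b -> C (m + n) (a * b);
  grading_sum a : exists N (c : nat -> A),
    (forall m, C m (c m)) /\ a = \sum_(m < N) c m;
  grading_direct N (c : nat -> A) : (forall m, C m (c m)) ->
    \sum_(m < N) c m = 0 -> forall m, (m < N)%N -> c m = 0
}.

Definition veronese_comp (m : nat) : A -> Prop := C (m * d).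

(* Membership in the direct sum of the components C (m * d). *)
Definition veronese (a : A) : Prop :=
  exists N (c : nat -> A),
    (forall m, veronese_comp m (c m)) /\ a = \sum_(m < N) c m.

End Veronese.

Definition graded_map (A B : Type) (C : nat -> A -> Prop) (D : nat -> B -> Prop)
    (v : A -> B) : Prop :=
  forall m a, C m a -> D m (v a).

Section YBGrading.
Variables (k : fieldType) (Z : finType) (r : Z * Z -> Z * Z).
Local Notation F := (free_alg k Z).
Local Notation I := (yb_tsideal k r).

Definition hcomp (m : nat) (p : F) : F :=
  [malg u in msupp p => if fdeg u == m then mcoeff u p else 0].

Definition mon (c : k) (u : {fmonom Z}) : F := << c *g u >>.

Lemma hcompE m p u : mcoeff u (hcomp m p) = if fdeg u == m then mcoeff u p else 0.
Proof. by rewrite mcoeffE; case: msuppP => // _; case: ifP. Qed.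

Lemma hcomp_is_zmod_morphism m : zmod_morphism (hcomp m).
Proof.
move=> p q; apply/malgP => u; rewrite hcompE.
rewrite [LHS](_ : _ = if fdeg u == m then mcoeff u p - mcoeff u q else 0); last first.
  by rewrite -(mcoeffB u).
by rewrite [RHS](mcoeffB u) !hcompE; case: ifP; rewrite ?subr0.
Qed.

HB.instance Definition _ m :=
  GRing.isZmodMorphism.Build F F (hcomp m) (hcomp_is_zmod_morphism m).

Lemma hcompU m c u :
  hcomp m (mon c u) = if fdeg u == m then mon c u else 0.
Proof.
apply/malgP => v; rewrite hcompE mcoeffU.
have [->|/negPf uv] := eqVneq u v.
  by case: ifP; rewrite ?mcoeffU ?eqxx ?mcoeff0.
by rewrite if_same; case: ifP; rewrite ?mcoeffU ?uv ?mcoeff0.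
Qed.

Lemma homogeneousP m (p : F) :
  (forall u, fdeg u != m -> mcoeff u p = 0) <-> homogeneous m p.
Proof.
split=> [p0 u|hp u] ; last by apply: contraNeq; rewrite mcoeff_neq0 => /hp/eqP.
by rewrite -mcoeff_neq0 => pu; apply/eqP; apply: contraNT pu => /p0/eqP.
Qed.

Lemma hcomp_homogeneous m p : homogeneous m (hcomp m p).
Proof. by apply/homogeneousP => u /negPf um; rewrite hcompE um. Qed.

Lemma hcomp_id m n p : homogeneous n p -> hcomp m p = if n == m then p else 0.
Proof.
move=> /homogeneousP hp; apply/malgP => u; rewrite hcompE.
have [nm|nm] := eqVneq n m; case: ifP => // um.
- by rewrite hp // nm um.
- by rewrite hp ?mcoeff0 // (eqP um) eq_sym.
- by rewrite mcoeff0.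
Qed.

Lemma free_monalgE (p : F) : p = \sum_(u <- msupp p) mon (mcoeff u p) u.
Proof. exact: monalgE. Qed.

Lemma free_mulUU c1 c2 u v :
  mon c1 u * mon c2 v = mon (c1 * c2) (mmul u v).
Proof. by rewrite [LHS]malgM_def fgmulUU. Qed.

Lemma hcompUM m c u (p : F) : hcomp m (mon c u * p) =
  if (fdeg u <= m)%N then mon c u * hcomp (m - fdeg u) p else 0.
Proof.
rewrite {1}(free_monalgE p) mulr_sumr raddf_sum.
rewrite {3}(free_monalgE p) raddf_sum mulr_sumr.
case: leqP => um; [apply: eq_bigr|apply: big1] => v _.
  rewrite /= free_mulUU !hcompU fdegM -{1}(subnKC um) eqn_add2l.
  by case: ifP; rewrite ?mulr0 // free_mulUU.
by rewrite /= free_mulUU hcompU fdegM ifN // gtn_eqF // ltn_addr.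
Qed.

Lemma hcompMU m c u (p : F) : hcomp m (p * mon c u) =
  if (fdeg u <= m)%N then hcomp (m - fdeg u) p * mon c u else 0.
Proof.
rewrite {1}(free_monalgE p) mulr_suml raddf_sum.
rewrite {3}(free_monalgE p) raddf_sum mulr_suml.
case: leqP => um; [apply: eq_bigr|apply: big1] => v _.
  rewrite /= free_mulUU !hcompU fdegM -{1}(subnK um) eqn_add2r.
  by case: ifP; rewrite ?mul0r // free_mulUU.
by rewrite /= free_mulUU hcompU fdegM ifN // gtn_eqF // ltn_addl.
Qed.

Lemma homogeneousD m (p q : F) :
  homogeneous m p -> homogeneous m q -> homogeneous m (p + q).
Proof.
move=> hp hq u /(fsubsetP (msuppD_le p q)); rewrite in_fsetU.
by case/orP => [/hp|/hq].
Qed.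

Lemma homogeneousZ m c (p : F) : homogeneous m p -> homogeneous m (c *: p).
Proof. by move=> hp u /(fsubsetP (msuppZ_le c p))/hp. Qed.

Lemma homogeneousM m n (p q : F) :
  homogeneous m p -> homogeneous n q -> homogeneous (m + n) (p * q).
Proof.
move=> hp hq u /msuppM_le [v [w [/hp <- /hq <- ->]]].
exact: fdegM.
Qed.

Lemma hcomp_ideal m p : ideal_gen (yb_rel r) p -> ideal_gen (yb_rel r) (hcomp m p).
Proof.
have I0 : ideal_gen (yb_rel r) (0 : F) := IdealGen_0 _.
have relh (p0 : F) : yb_rel r p0 -> homogeneous 2 p0.
  have h1 (z : Z) : homogeneous 1 (gen k z) by move=> u; rewrite msuppU1 inE => /eqP->; exact: fdegU.
  have h2 (x y : Z) : homogeneous 2 (gen k x * gen k y) := homogeneousM (h1 x) (h1 y).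
  move=> [x [y ->]]; apply: homogeneousD => //.
  by rewrite -scaleN1r; apply: homogeneousZ.
move=> Ip; elim: Ip m => {p} [p Ip||p q _ Ip _ Iq|a p _ Ip|a p _ Ip] m.
- rewrite (hcomp_id _ (relh _ Ip)); case: ifP => _; [exact: IdealGen_base|exact: IdealGen_0].
- rewrite [hcomp m 0]raddf0; exact: I0.
- by rewrite [hcomp m _]raddfB; exact: IdealGen_B (Ip m) (Iq m).
- rewrite (free_monalgE a) mulr_suml raddf_sum /=; apply/yb_idealP.
  apply: (@rpred_sum _ I) => u _; apply/yb_idealP; rewrite hcompUM.
  by case: ifP => _; [exact: IdealGen_Ml|exact: I0].
- rewrite (free_monalgE a) mulr_sumr raddf_sum /=; apply/yb_idealP.
  apply: (@rpred_sum _ I) => u _; apply/yb_idealP; rewrite hcompMU.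
  by case: ifP => _; [exact: IdealGen_Mr|exact: I0].
Qed.

Lemma yb_grading : is_grading (yb_comp k r).
Proof.
split.
- move=> m c a b [p hp ->] [q hq ->]; exists (c *: p + q).
    by apply: homogeneousD => //; apply: homogeneousZ.
  by rewrite linearP.
- exists 1; last by rewrite rmorph1.
  by move=> u; rewrite [msupp _]msuppU1 inE => /eqP->; exact: fdeg1.
- move=> m n a b [p hp ->] [q hq ->]; exists (p * q); last by rewrite rmorphM.
  exact: homogeneousM.
- move=> a; pose p := quot_repr a.
  exists (mmeasure (@fdeg Z) p), (fun m => quot_proj I (hcomp m p)); split.
    by move=> m; exists (hcomp m p) => //; apply: hcomp_homogeneous.
  rewrite -raddf_sum -[LHS]quot_reprK; congr quot_proj; rewrite -/p.
  apply/malgP => u; rewrite (raddf_sum (mcoeff u)).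
  under eq_bigr do rewrite /= hcompE.
  have [up|up] := boolP (u \in msupp p); last first.
    by rewrite mcoeff_outdom // big1 // => i _; case: ifP.
  rewrite (bigD1 (Ordinal (mmeasure_mnm_lt _ up))) //= eqxx big1 ?addr0 // => i.
  by rewrite -val_eqE /= eq_sym => /negPf->.
- move=> N c cC c0 m mN.
  have /choice[q hq] : forall i, exists p, homogeneous i p /\ c i = quot_proj I p.
    by move=> i; have [p hp cp] := cC i; exists p.
  have Iq : \sum_(i < N) q i \in I.
    rewrite -[X in X \in _]subr0; apply/quot_projP.
    by rewrite raddf0 -c0 raddf_sum; apply: eq_bigr => i _; rewrite (hq i).2.
  have {Iq} := hcomp_ideal m (asboolW Iq).
  rewrite raddf_sum (bigD1 (Ordinal mN)) //= (hcomp_id _ (hq m).1) eqxx.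
  rewrite big1 ?addr0 => [Im|i]; last first.
    by rewrite -val_eqE /= (hcomp_id _ (hq i).1) => /negPf->.
  rewrite (hq m).2 -(raddf0 (quot_proj I)); apply/quot_projP.
  by rewrite subr0; apply/yb_idealP.
Qed.

End YBGrading.

(* Main.v *)
Require Import Defs.
From HB Require Import structures.
From mathcomp Require Import all_boot all_order all_fingroup all_algebra.
From mathcomp Require Import finmap boolp monalg.

Set Implicit Arguments.
Unset Strict Implicit.
Unset Printing Implicit Defensive.

Import GRing.Theory.
Local Open Scope ring_scope.

(** In a Yang-Baxter algebra of a permutation idempotent solution the relations
    [x y = g(y) y], with [x] arbitrary and a right-hand side that does not
    involve [x], amount to [x y = z y] for all [x, y, z]. Hence a word in the
    generators depends only on its length and on its last letter: if this letter
    is [z], a word of length [m] equals [z^m]. Call the pair (length, last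
    letter) the class of the word.

    Conversely, the class of a product of words depends only on the classes of
    the factors, so the elements of the free algebra whose coefficients sum to
    zero over each class form a two-sided ideal, and this ideal contains the
    relations. So an element of the free algebra vanishes in the Yang-Baxter
    algebra if and only if each of its class sums is zero
    ([quot_proj_eq0]); the permutation [g] has disappeared, and the classes
    index a basis.

    In these terms [w_q = x_1^(d-1) x_q] is [x_q^d], and the Veronese map is
    induced by the substitution [y_q |-> x_q^d] of free algebras. This
    substitution sends the class [(m, y_q)] to [(m d, x_q)], an injective map on
    classes, so an element has zero class sums if and only if its image does
    ([class_null_subst]). One direction makes the map well defined on the
    quotient, the other makes it injective. Its image is the Veronese subalgebra
    because every word of length [m d] in the [x]s has the class of some
    substituted word of length [m]. The presentation by the relations
    [y_p y_q - y_1 y_q] is again the remark that [x y = z y], and [F] is a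
    well-defined permutation because the elements [x_q^d] are distinct. *)

(** * Rings and words *)

Lemma expr_absorb (R : nzRingType) (a b : R) m n :
  a * b = b * b -> (0 < n)%N -> a ^+ m * b ^+ n = b ^+ (m + n).
Proof.
move=> ab; case: n => // n _; elim: m => [|m IH]; first by rewrite mul1r.
by rewrite exprS -mulrA IH addSn addnS [in LHS]exprS mulrA ab -mulrA -!exprS.
Qed.

Lemma mulr_sum3 (R : nzRingType) (I J K : Type) (r : seq I) (s : seq J)
    (t : seq K) (F : I -> R) (G : J -> R) (H : K -> R) :
  (\sum_(i <- r) F i) * (\sum_(j <- s) G j) * (\sum_(l <- t) H l) =
  \sum_(i <- r) \sum_(l <- t) \sum_(j <- s) F i * G j * H l.
Proof.
rewrite mulr_suml mulr_suml; apply: eq_bigr => i _.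
rewrite mulr_sumr; apply: eq_bigr => l _.
by rewrite mulr_sumr mulr_suml.
Qed.

Lemma fmonom_mulE (Z : finType) (u v : {fmonom Z}) :
  mmul u v = FMonom (u ++ v).
Proof. by apply/eqP; rewrite fmP fmM. Qed.

Lemma fmonom_oneE (Z : finType) : mone = FMonom [::] :> {fmonom Z}.
Proof. by apply/eqP; rewrite fmP fm1. Qed.

(** * Universal properties of quotients and of free algebras *)

Section Lifts.
Variables (k : fieldType).

Lemma quot_lift (R B : algType k) (I : tsideal R) (phi : {lrmorphism R -> B}) :
  (forall p, quot_proj I p = 0 -> phi p = 0) ->
  exists v : {lrmorphism quot_alg I -> B}, forall p, v (quot_proj I p) = phi p.
Proof.
move=> phi0; pose v (a : quot_alg I) : B := phi (quot_repr a).
have vE p : v (quot_proj I p) = phi p.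
  apply/eqP; rewrite -subr_eq0 -raddfB; apply/eqP/phi0.
  by rewrite raddfB /= [quot_proj I (quot_repr _)]quot_reprK subrr.
have vB : zmod_morphism v.
  by move=> a b; rewrite -[a]quot_reprK -[b]quot_reprK -raddfB !vE raddfB.
have vM : monoid_morphism v.
  split=> [|a b]; first by rewrite -(rmorph1 (quot_proj I)) vE rmorph1.
  by rewrite -[a]quot_reprK -[b]quot_reprK -rmorphM !vE rmorphM.
have vZ : scalable v.
  by move=> c a; rewrite -[a]quot_reprK -linearZ !vE linearZ.
pose v1 := GRing.isZmodMorphism.Build _ _ v vB.
pose v2 := GRing.isMonoidMorphism.Build _ _ v vM.
pose v3 := GRing.isScalable.Build _ _ _ _ v vZ.
pose V : {lrmorphism quot_alg I -> B} := HB.pack v v1 v2 v3.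
by exists V.
Qed.

Lemma free_lift (Z : finType) (B : algType k) (b : Z -> B) :
  exists phi : {lrmorphism free_alg k Z -> B},
    forall c u, phi (mon c u) = c *: \prod_(z <- (u : seq Z)) b z.
Proof.
pose h (u : {fmonom Z}) : B := \prod_(z <- (u : seq Z)) b z.
have hM : mmorphism h.
  by split=> [u v|]; rewrite /h ?fm1 ?big_nil // fmM big_cat.
pose h1 := isMultiplicative.Build _ _ h hM.
pose H : {mmorphism {fmonom Z} -> B} := HB.pack h h1.
pose phi : free_alg k Z -> B := mmap (GRing.in_alg B) H.
have phiB : zmod_morphism phi by exact: mmap_is_additive.
have phiM : monoid_morphism phi.
  have [] := @commr_mmap_is_multiplicative _ _ _ (GRing.in_alg B) H.
    by move=> g m m'; rewrite /GRing.comm /= mulr_algl mulr_algr.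
  by split.
have phiZ : scalable phi.
  by move=> c p; rewrite /phi mmapZ /= mulr_algl.
pose v1 := GRing.isZmodMorphism.Build _ _ phi phiB.
pose v2 := GRing.isMonoidMorphism.Build _ _ phi phiM.
pose v3 := GRing.isScalable.Build _ _ _ _ phi phiZ.
pose V : {lrmorphism free_alg k Z -> B} := HB.pack phi v1 v2 v3.
by exists V => c u; rewrite /= /phi mmapU /= mulr_algl.
Qed.

Lemma mon_scale (Z : finType) (c : k) (u : {fmonom Z}) : mon c u = c *: mon 1 u.
Proof. by apply/malgP => v; rewrite mcoeffZ !mcoeffU mulr_natr. Qed.

Lemma mon_word (Z : finType) (s : seq Z) :
  mon 1 (FMonom s) = \prod_(z <- s) gen k z.
Proof.
elim: s => [|x s IH]; first by rewrite big_nil -fmonom_oneE.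
by rewrite big_cons -IH [gen k x * _]free_mulUU mulr1 fmonom_mulE fmU.
Qed.

End Lifts.

(** * Sums of coefficients over word classes *)

Section Classes.
Variables (k : fieldType) (Z : finType).

(** The last letter is an option so that the empty word is a class of its own. *)
Definition word_class (s : seq Z) : nat * option Z := (size s, ohead (rev s)).

(** The product that word classes inherit from concatenation: a nonempty right
    factor imposes its last letter. *)
Definition class_mul (c c' : nat * option Z) : nat * option Z :=
  ((c.1 + c'.1)%N, if c'.1 is 0 then c.2 else c'.2).

Lemma word_class_cat (s t : seq Z) :
  word_class (s ++ t) = class_mul (word_class s) (word_class t).
Proof.
case: t => [|z t]; first by rewrite cats0 /word_class /class_mul addn0.
rewrite /word_class /class_mul size_cat rev_cat rev_cons.
by case: (rev t).
Qed.

Definition class_coef (c : nat * option Z) : free_alg k Z -> k :=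
  mmap idfun (fun u : {fmonom Z} => (word_class u == c)%:R).

Definition class_coef_is_zmod_morphism c : zmod_morphism (class_coef c) :=
  @mmap_is_additive _ _ _ idfun _.

HB.instance Definition _ c :=
  GRing.isZmodMorphism.Build (free_alg k Z) k (class_coef c)
    (class_coef_is_zmod_morphism c).

Lemma class_coef_mon c a u :
  class_coef c (mon a u) = a * (word_class u == c)%:R.
Proof. exact: mmapU. Qed.

(** A linear map that sees only the class of a word factors through the class
    sums: group the words of the support by class. *)
Lemma sum_over_classes (V : lmodType k) (h : nat * option Z -> V)
    (p : free_alg k Z) :
  \sum_(u <- msupp p) mcoeff u p *: h (word_class u) =
  \sum_(c <- undup [seq word_class u | u : {fmonom Z} <- msupp p])
     class_coef c p *: h c.
Proof.
under [RHS]eq_bigr do rewrite [class_coef _ _]mmapE scaler_suml.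
rewrite exchange_big /= [LHS]big_seq [RHS]big_seq; apply: eq_bigr => u pu.
have cl_u : word_class u \in undup [seq word_class v | v : {fmonom Z} <- msupp p].
  by rewrite mem_undup; apply/mapP; exists u.
rewrite (bigD1_seq (word_class u)) ?undup_uniq //=.
rewrite eqxx mulr1 big1 ?addr0 // => c /negPf cu.
by rewrite eq_sym cu mulr0 scale0r.
Qed.

Definition class_null (p : free_alg k Z) := forall c, class_coef c p = 0.

Lemma class_null_sum (V : lmodType k) (h : nat * option Z -> V) p :
  class_null p -> \sum_(u <- msupp p) mcoeff u p *: h (word_class u) = 0.
Proof.
by move=> p0; rewrite sum_over_classes big1 // => c _; rewrite p0 scale0r.
Qed.

Lemma linear_sum_mon (V : lmodType k) (L : {linear free_alg k Z -> V}) p :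
  L p = \sum_(u <- msupp p) mcoeff u p *: L (mon 1 u).
Proof.
rewrite {1}(free_monalgE p) raddf_sum; apply: eq_bigr => u _ /=.
by rewrite mon_scale linearZ.
Qed.

(** For fixed words [u] and [v], the class of [u t v] is a function of the class
    of [t], so each class sum of [u p v] is a combination of class sums of
    [p]. *)
Lemma class_nullM a p b : class_null p -> class_null (a * p * b).
Proof.
move=> p0 c; rewrite (free_monalgE a) (free_monalgE b) {1}(free_monalgE p).
rewrite mulr_sum3 raddf_sum big1 // => u _ /=; rewrite raddf_sum big1 // => v _ /=.
rewrite raddf_sum /=.
(* For the words [u] of [a] and [v] of [b], [h c'] is the weight with which the
   class sum of [p] at [c'] enters the class sum of the product at [c]. *)
pose h (c' : nat * option Z) : k^o := mcoeff u a * mcoeff v b *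
  (class_mul (class_mul (word_class u) c') (word_class v) == c)%:R.
rewrite -[RHS](class_null_sum h p0); apply: eq_bigr => t _.
rewrite !free_mulUU class_coef_mon !fmonom_mulE !word_class_cat.
rewrite -[RHS]/(mcoeff t p * (mcoeff u a * mcoeff v b * _)) mulrA [in RHS]mulrCA.
by rewrite [in RHS](mulrA (mcoeff u a)).
Qed.

End Classes.

(** * The Yang-Baxter algebra of a permutation idempotent solution *)

Section PermIdem.
Variables (k : fieldType) (Z : finType) (g : {perm Z}).
Local Notation r := (perm_idem_sol g).
Local Notation I := (yb_tsideal k r).
Local Notation xi := (yb_gen k r).

(** Both sides equal [g(y) y]. *)
Lemma yb_gen_mul x y : xi x * xi y = xi y * xi y.
Proof.
suff E z : xi z * xi y = xi (g y) * xi y by rewrite !E.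
rewrite /yb_gen -!rmorphM; apply/quot_projP/yb_idealP/IdealGen_base.
by exists z, y.
Qed.

Lemma yb_genX_mulX x y m n : (0 < n)%N ->
  xi x ^+ m * xi y ^+ n = xi y ^+ (m + n).
Proof. exact/expr_absorb/yb_gen_mul. Qed.

Lemma yb_genX_mul x y m : (0 < m)%N -> xi x * xi y ^+ m = xi y ^+ m.+1.
Proof. exact: (yb_genX_mulX x y 1). Qed.

(** The common value [z^m] of all words of length [m] ending in [z]; only the
    empty word has no last letter. *)
Definition class_nf (c : nat * option Z) : yb_alg k r :=
  if c.2 is Some z then xi z ^+ c.1 else 1.

Lemma prod_class_nf (s : seq Z) : \prod_(z <- s) xi z = class_nf (word_class s).
Proof.
elim: s => [|x s IH]; first by rewrite big_nil.
rewrite big_cons IH; case/lastP: s {IH} => [|s z].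
  by rewrite /class_nf /= mulr1.
by rewrite /class_nf /word_class -rcons_cons !rev_rcons !size_rcons /= yb_genX_mul.
Qed.

Lemma quot_proj_mon (u : {fmonom Z}) :
  quot_proj I (mon 1 u) = class_nf (word_class u).
Proof.
by rewrite -[u]fmK mon_word rmorph_prod prod_class_nf.
Qed.

(** Modulo the ideal, [p] is the combination of the normal forms [class_nf] with
    the class sums as coefficients, which gives one direction. For the other, the
    elements with zero class sums form a two-sided ideal that contains the two
    words of each relation with opposite coefficients: both have length two and
    the same last letter. *)
Theorem quot_proj_eq0 (p : free_alg k Z) :
  quot_proj I p = 0 <-> class_null p.
Proof.
split=> [|p0]; last first.
  rewrite linear_sum_mon; under eq_bigr do rewrite /= quot_proj_mon.
  exact: class_null_sum.
rewrite -(raddf0 (quot_proj I)) => /quot_projP; rewrite subr0 => /yb_idealP.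
have gen2 a b : gen k a * gen k b = mon 1 (FMonom [:: a; b]).
  by rewrite mon_word !big_cons big_nil mulr1.
elim=> {p} [p [x [y ->]]||p q _ Ip _ Iq|a p _ Ip|a p _ Ip] c.
- by rewrite raddfB !gen2 /= !class_coef_mon subrr.
- exact: raddf0.
- by rewrite raddfB /= Ip Iq subrr.
- by rewrite -[_ * _]mulr1 class_nullM.
- by rewrite -[p]mul1r class_nullM.
Qed.

End PermIdem.

(** The class sums separate the normal forms, because the sum at the class of [t]
    takes the value [1] on the word [t] and vanishes on words of other
    classes. *)
Lemma class_nf_inj (k : fieldType) (Z : finType) (g : {perm Z}) (s t : seq Z) :
  class_nf k g (word_class s) = class_nf k g (word_class t) ->
  word_class s = word_class t.
Proof.
rewrite -[s]/(FMonom s : seq Z) -[t]/(FMonom t : seq Z) -!quot_proj_mon.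
move=> /eqP; rewrite -subr_eq0 -raddfB => /eqP/quot_proj_eq0/(_ (word_class t)).
rewrite raddfB /= !class_coef_mon !mul1r eqxx.
by case: eqP => // _ /eqP; rewrite sub0r oppr_eq0 oner_eq0.
Qed.

Lemma yb_genX_inj (k : fieldType) (Z : finType) (g : {perm Z}) m (m_gt0 : (0 < m)%N) :
  injective (fun z => yb_gen k (perm_idem_sol g) z ^+ m).
Proof.
have classE z : word_class (nseq m z) = (m, Some z).
  by rewrite /word_class size_nseq rev_nseq -(prednK m_gt0).
move=> z t E.
suff : word_class (nseq m z) = word_class (nseq m t) by rewrite !classE => -[].
by apply: (@class_nf_inj k _ g); rewrite !classE; exact: E.
Qed.

(** * The Veronese map *)

Section Veronese.
Variables (k : fieldType) (X Y : finType) (f : {perm X}) (g : {perm Y}).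
Variables (d : nat) (tau : Y -> X) (tau' : X -> Y).
Hypotheses (d_gt0 : (0 < d)%N) (tauK : cancel tau tau') (tau'K : cancel tau' tau).
Local Notation rf := (perm_idem_sol f).
Local Notation rg := (perm_idem_sol g).

Definition word_subst (s : seq Y) : seq X := flatten [seq nseq d (tau z) | z <- s].

Definition class_subst (c : nat * option Y) : nat * option X :=
  ((c.1 * d)%N, omap tau c.2).

Lemma class_subst_inj : injective class_subst.
Proof.
move=> [m o] [m' o'] [] /eqP; rewrite eqn_pmul2r // => /eqP -> /=.
by case: o o' => [z|] [z'|] //= [] /(can_inj tauK) ->.
Qed.

(** Since [d > 0], the block of copies that replaces the last letter is nonempty
    and hands this letter on. *)
Lemma word_class_subst s : word_class (word_subst s) = class_subst (word_class s).
Proof.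
elim: s => [//|z s IH]; rewrite -cat1s {1}/word_subst map_cat flatten_cat.
rewrite !word_class_cat IH /class_mul /class_subst /= addn0 mulnDl mul1n.
rewrite size_nseq rev_nseq -(prednK d_gt0).
by case: (size s).
Qed.

Lemma free_subst : exists phi : {lrmorphism free_alg k Y -> free_alg k X},
  forall c (u : {fmonom Y}), phi (mon c u) = mon c (FMonom (word_subst u)).
Proof.
have [phi phiE] := free_lift (B := free_alg k X) (fun z => gen k (tau z) ^+ d).
exists phi => c u; rewrite phiE mon_scale mon_word big_flatten big_map.
by congr (c *: _); apply: eq_bigr => z _; rewrite big_nseq iter_mulr_1.
Qed.

Lemma class_coef_subst (phi : {lrmorphism free_alg k Y -> free_alg k X}) c p :
  (forall a (u : {fmonom Y}), phi (mon a u) = mon a (FMonom (word_subst u))) ->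
  class_coef c (phi p) =
  \sum_(u <- msupp p) mcoeff u p * (class_subst (word_class u) == c)%:R.
Proof.
move=> phiE; rewrite {1}(free_monalgE p) !raddf_sum; apply: eq_bigr => u _.
by rewrite /= phiE class_coef_mon word_class_subst.
Qed.

(** A class sum of [phi p] is either zero or the class sum of [p] at the unique
    preimage of the class; this is what makes the Veronese map both well defined
    and injective. *)
Lemma class_null_subst (phi : {lrmorphism free_alg k Y -> free_alg k X}) p :
  (forall a (u : {fmonom Y}), phi (mon a u) = mon a (FMonom (word_subst u))) ->
  class_null (phi p) <-> class_null p.
Proof.
move=> phiE; split=> p0 c.
  rewrite -[RHS](p0 (class_subst c)) class_coef_subst //.
  by apply: eq_bigr => u _; rewrite (inj_eq class_subst_inj).
rewrite class_coef_subst //.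
exact: (class_null_sum (V := k^o) (fun c' => (class_subst c' == c)%:R) p0).
Qed.

Lemma homogeneous_subst (phi : {lrmorphism free_alg k Y -> free_alg k X}) m p :
  (forall a (u : {fmonom Y}), phi (mon a u) = mon a (FMonom (word_subst u))) ->
  homogeneous m p -> homogeneous (m * d) (phi p).
Proof.
move=> phiE hp; rewrite (free_monalgE p) raddf_sum big_seq.
apply: big_ind => [u||u /hp um v].
- by rewrite msupp0 inE.
- exact: homogeneousD.
rewrite /= phiE => /(fsubsetP (@msuppU_le _ _ _ _)).
rewrite inE => /eqP ->; rewrite -um.
by have [] := word_class_subst u.
Qed.

(** The substitution followed by the projection has the Yang-Baxter ideal of [Y]
    as its exact kernel, so it induces an injective map. For the image, a
    homogeneous element of degree [m d] is a combination of normal forms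
    [z^(m d) = (z^d)^m], and [z^d] is the image of a generator. *)
Theorem veronese_map : exists v : {lrmorphism yb_alg k rg -> yb_alg k rf},
  [/\ forall z, v (yb_gen k rg z) = yb_gen k rf (tau z) ^+ d,
      graded_map (yb_comp k rg) (veronese_comp (yb_comp k rf) d) v,
      injective v &
      forall a, (exists b, v b = a) <-> veronese (yb_comp k rf) d a].
Proof.
have [phi phiE] := free_subst.
pose pi := quot_proj (yb_tsideal k rf).
pose psi : {lrmorphism free_alg k Y -> yb_alg k rf} := pi \o phi.
have psi0 p : psi p = 0 <-> quot_proj (yb_tsideal k rg) p = 0.
  rewrite !quot_proj_eq0; exact: class_null_subst.
have [v vE] := quot_lift (fun p => (psi0 p).2).
have v_gen z : v (yb_gen k rg z) = yb_gen k rf (tau z) ^+ d.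
  rewrite vE -[gen k z]/(mon 1 (fmu z)) /psi /= phiE fmU mon_word rmorph_prod /=.
  by rewrite /word_subst /= cats0 big_nseq iter_mulr_1.
have v_graded : graded_map (yb_comp k rg) (veronese_comp (yb_comp k rf) d) v.
  move=> m _ [p hp ->]; rewrite vE; exists (phi p) => //.
  exact: homogeneous_subst.
exists v; split=> // [|a].
  apply: raddf_inj => b; rewrite -(quot_reprK b) /= vE => vb0; exact: (psi0 _).1 vb0.
split=> [[b <-]|[N [c [hc ->]]]].
  have [N [c [hc ->]]] := grading_sum (yb_grading k rg) b.
  exists N, (fun m => v (c m)); split=> [m|]; first exact: v_graded.
  exact: raddf_sum.
suff {N} im m : exists b, v b = c m.
  have [b bE] := choice im; exists (\sum_(m < N) b m).
  by rewrite raddf_sum; apply: eq_bigr => m _; exact: bE.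
have [p hp ->] := hc m.
(* All words in the support have length [m * d], so the first component of the
   class carries no information and is replaced by [m]. *)
pose h (c : nat * option X) : yb_alg k rg := class_nf k g (m, omap tau' c.2).
exists (\sum_(u <- msupp p) mcoeff u p *: h (word_class u)).
rewrite linear_sum_mon raddf_sum big_seq [RHS]big_seq; apply: eq_bigr => u /hp um.
rewrite /= linearZ /= quot_proj_mon; congr (_ *: _).
rewrite /h /class_nf /= -[size u]/(fdeg u) um.
case: (ohead _) => [z|] /=; last exact: rmorph1.
by rewrite rmorphXn /= v_gen tau'K mulnC exprM.
Qed.

End Veronese.

(** * The presentation by differences with the first generator *)

Lemma ideal_gen_min (R : nzRingType) (S T : R -> Prop) :
  (forall p, S p -> ideal_gen T p) -> forall p, ideal_gen S p -> ideal_gen T p.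
Proof.
move=> ST p; elim=> {p} [p /ST //||p q _ Tp _ Tq|a p _ Tp|a p _ Tp].
- exact: IdealGen_0.
- exact: IdealGen_B.
- exact: IdealGen_Ml.
- exact: IdealGen_Mr.
Qed.

(** Used with [c] a monomial to which both [a] and [b] are congruent. *)
Lemma ideal_gen_sub_trans (R : nzRingType) (S : R -> Prop) (c a b : R) :
  ideal_gen S (a - c) -> ideal_gen S (b - c) -> ideal_gen S (a - b).
Proof.
move=> Sac Sbc; have -> : a - b = (a - c) - (b - c) by rewrite opprB addrA subrK.
exact: IdealGen_B.
Qed.

(** Either family of relations makes all the products [x y] with a fixed right
    factor [y] congruent: to [g(y) y] in one case, to [y_1 y] in the other. *)
Lemma ideal_gen_first_column (k : fieldType) (Y : finType) (g : {perm Y}) (n : nat)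
    (i1 : 'I_n) (y : 'I_n -> Y) (u : free_alg k Y) :
  i1 = 0%N :> nat -> bijective y ->
  ideal_gen (yb_rel (perm_idem_sol g)) u <->
  ideal_gen (fun v => exists p q : 'I_n, (0 < p)%N /\
     v = gen k (y p) * gen k (y q) - gen k (y i1) * gen k (y q)) u.
Proof.
move=> i10 [y' yK y'K]; split; apply: ideal_gen_min => {}u.
- move=> [a [b ->]]; set S := fun _ => _.
  have S1 c : ideal_gen S (gen k c * gen k b - gen k (y i1) * gen k b).
    have [y'c0|y'c0] := posnP (y' c).
      have <- : y i1 = c by rewrite -(y'K c); congr y; apply: val_inj; rewrite /= y'c0.
      by rewrite subrr; apply: IdealGen_0.
    by apply: IdealGen_base; exists (y' c), (y' b); rewrite !y'K.
  exact: (ideal_gen_sub_trans (S1 a) (S1 (g b))).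
- move=> [p [q [_ ->]]].
  have rel c : ideal_gen (yb_rel (perm_idem_sol g))
      (gen k c * gen k (y q) - gen k (g (y q)) * gen k (y q)).
    by apply: IdealGen_base; exists c, (y q).
  exact: (ideal_gen_sub_trans (rel (y p)) (rel (y i1))).
Qed.

Theorem corollary6p14 (k : fieldType) (n : nat) (hn : (2 <= n)%N)
    (X : finType) (x : 'I_n -> X) (hx : bijective x) (f : {perm X})
    (d : nat) (hd : (2 <= d)%N)
    (Y : finType) (y : 'I_n -> Y) (hy : bijective y) :
  let i1 : 'I_n := Ordinal (ltnW hn) in
  let rf := perm_idem_sol f in
  let xi := yb_gen k rf in
  let w : 'I_n -> yb_alg k rf := fun q => xi (x i1) ^+ d.-1 * xi (x q) in
  let w_ : 'I_n -> seq_sub (codom w) := fun q => SeqSub (codom_f w q) in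
  let is_F (F : {perm seq_sub (codom w)}) : Prop :=
    forall q, val (F (w_ q)) = xi (x i1) ^+ d.-1 * xi (iter d f (x q)) in
  let is_FF (F : {perm seq_sub (codom w)}) (FF : {perm Y}) : Prop :=
    forall q j, FF (y q) = y j <-> F (w_ q) = w_ j in
  (exists F FF, is_F F /\ is_FF F FF) /\
  forall F FF, is_F F -> is_FF F FF ->
    let rFF := perm_idem_sol FF in
    (forall u : free_alg k Y, ideal_gen (yb_rel rFF) u <->
       ideal_gen (fun v => exists p q : 'I_n, (0 < p)%N /\
         v = gen k (y p) * gen k (y q) - gen k (y i1) * gen k (y q)) u) /\
    exists v : {lrmorphism yb_alg k rFF -> yb_alg k rf},
      [/\ forall i, v (yb_gen k rFF (y i)) = w i,
          graded_map (yb_comp k rFF) (veronese_comp (yb_comp k rf) d) v,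
          injective v &
          forall a, (exists b, v b = a) <-> veronese (yb_comp k rf) d a].
Proof.
move=> i1 rf xi w w_ is_F is_FF.
have d_gt0 : (0 < d)%N := ltnW hd.
have [x' xK x'K] := hx; have [y' yK y'K] := hy.
have wE z : xi (x i1) ^+ d.-1 * xi z = xi z ^+ d.
  by rewrite -[xi z in LHS]expr1 yb_genX_mulX // addn1 prednK.
split=> [|F FF _ _ rFF]; last first.
  split=> [u|]; first exact: ideal_gen_first_column.
  have tauK : cancel (x \o y') (y \o x') by move=> z /=; rewrite xK y'K.
  have tau'K : cancel (y \o x') (x \o y') by move=> z /=; rewrite yK x'K.
  have [v [v_gen v_gr v_inj v_im]] := veronese_map k f FF d_gt0 tauK tau'K.
  by exists v; split=> // i; rewrite v_gen /= yK /w wE.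
have w_inj : injective w.
  by move=> p q; rewrite /w !wE => /(yb_genX_inj d_gt0)/(can_inj xK).
have w_K q (s : 'I_n) : w_ q = w_ s -> q = s by move=> /(congr1 val)/w_inj.
(* [f^d] transported to indices; both [F] and [FF] are conjugates of it. *)
pose s (q : 'I_n) : 'I_n := x' (iter d f (x q)).
have s_inj : injective s.
  move=> p q /(can_inj x'K) E; apply: (can_inj xK).
  by elim: d E {hd d_gt0 w w_ is_F is_FF wE w_inj w_K s} => // m IH /perm_inj.
pose idx (a : seq_sub (codom w)) : 'I_n := iinv (ssvalP a).
have idxK : cancel idx w_ by move=> a; apply: val_inj; rewrite /= f_iinv.
have w_idx : cancel w_ idx by move=> q; apply: w_K; rewrite idxK.
have F_inj : injective (w_ \o s \o idx).
  by move=> a b /w_K/s_inj/(can_inj idxK).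
have FF_inj : injective (y \o s \o y').
  by move=> a b /(can_inj yK)/s_inj/(can_inj y'K).
exists (perm F_inj), (perm FF_inj); split=> [q|q j]; rewrite !permE /=.
  by rewrite w_idx /w x'K.
rewrite yK w_idx; split=> [/(can_inj yK) ->|/w_K ->] //.
Qed.
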